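(* Let $X$ be a Banach space. Let $\mathbf M:X\otimes(S)_{-1}\to X\otimes S'(\mathbb R)\otimes(S)_{-1}$ be of the form $$\mathbf M u=\sum_{k=1}^\infty \mathbf M_k u\otimes\xi_k,\qquad u\in X\otimes(S)_{-1},$$ for some simple coordinatewise operators $\mathbf M_k:X\otimes(S)_{-1}\to X\otimes(S)_{-1}$, $k\in\mathbb N$. Then there exists a coordinatewise operator $\mathbf B$, given by a family $\{B_\alpha\}_{\alpha\in\mathcal I}$, such that $B_\alpha=0$ whenever $\alpha\notin\{\varepsilon_k:k\in\mathbb N\}$ and $$\delta(\mathbf M u)=\mathbf B\lozenge u\qquad\text{for all }u\in X\otimes(S)_{-1}.$$ Conversely, for any coordinatewise operator $\mathbf B$ with $B_\alpha=0$ whenever $\alpha\notin\{\varepsilon_k:k\in\mathbb N\}$, there exists an operator $\mathbf M$ of the form $\mathbf M u=\sum_{k=1}^\infty\mathbf M_k u\otimes\xi_k$ for some simple coordinatewise operators $\mathbf M_k$, $k\in\mathbb N$, such that $\delta(\mathbf M u)=\mathbf B\lozenge u$ for all $u\in X\otimes(S)_{-1}$.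
   Context: $\mathcal I=(\mathbb N_0^{\mathbb N})_c$ is the set of sequences of non-negative integers with only finitely many nonzero entries, with componentwise operations and order; $\varepsilon_k\in\mathcal I$ has entry $1$ at place $k$ and $0$ elsewhere. $(2\mathbb N)^{c\alpha}=\prod_{n\ge1}(2n)^{c\alpha_n}$. $\xi_k$, $k\in\mathbb N$, are the Hermite functions and $\{H_\alpha\}_{\alpha\in\mathcal I}$ the Fourier–Hermite orthogonal basis of $L^2(S'(\mathbb R),\mu)$, $\mu$ the Gaussian white noise measure. Expansions are formal series identified with their coefficient families. $X\otimes(S)_{-1}$ is the space of expansions $u=\sum_\alpha u_\alpha H_\alpha$, $u_\alpha\in X$, for which there is $p\ge0$ with $\sum_\alpha\|u_\alpha\|_X^2(2\mathbb N)^{-p\alpha}<\infty$. $X\otimes S'(\mathbb R)\otimes(S)_{-1}$ is the space of expansions $F=\sum_\alpha\sum_{k}f_{\alpha,k}\otimes\xi_k\otimes H_\alpha$, $f_{\alpha,k}\in X$, for which there are $l,p\ge0$ with $\sum_\alpha\sum_k\|f_{\alpha,k}\|_X^2(2k)^{-l}(2\mathbb N)^{-p\alpha}<\infty$. The Skorokhod integral $\delta:X\otimes S'(\mathbb R)\otimes(S)_{-1}\to X\otimes(S)_{-1}$ is $$\delta(F)=\sum_\alpha\sum_k f_{\alpha,k}H_{\alpha+\varepsilon_k}.$$ An operator $\mathbf O:X\otimes(S)_{-1}\to X\otimes(S)_{-1}$ is coordinatewise if there are operators $o_\alpha:X\to X$, $\alpha\in\mathcal I$, with $\mathbf O(\sum_\alpha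 f_\alpha H_\alpha)=\sum_\alpha o_\alpha(f_\alpha)H_\alpha$ for all elements of $X\otimes(S)_{-1}$; it is simple coordinatewise if all $o_\alpha$ equal one operator $o:X\to X$. For a coordinatewise operator $\mathbf B$ with components $B_\alpha:X\to X$, the Wick action $\mathbf B\lozenge:X\otimes(S)_{-1}\to X\otimes(S)_{-1}$, understood throughout to be well defined as a map between these spaces, is $$\mathbf B\lozenge u=\sum_{\alpha\in\mathcal I}\sum_{\beta\le\alpha}B_\beta(u_{\alpha-\beta})H_\alpha,\qquad u=\sum_{\alpha\in\mathcal I}u_\alpha H_\alpha .$$ *)

(* Defs.v *)
From HB Require Import structures.
From mathcomp Require Import all_boot all_order all_algebra finmap.
From mathcomp Require Import all_classical all_reals all_analysis.

Set Implicit Arguments.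
Unset Strict Implicit.
Unset Printing Implicit Defensive.

Import Order.TTheory GRing.Theory Num.Theory.
Import numFieldNormedType.Exports.

Local Open Scope classical_set_scope.
Local Open Scope ring_scope.

(** Multi-indices.  Places are numbered from 0: [a n] is the entry of the
    multi-index at place n+1, whose weight is therefore 2(n+1). *)
Definition multiindex := {fsfun nat -> nat with 0%N}.

Definition madd (a b : multiindex) : multiindex :=
  [fsfun n in (finsupp a `|` finsupp b)%fset => (a n + b n)%N | 0%N].

(** Truncated subtraction; only used when [b] is below [a]. *)
Definition msub (a b : multiindex) : multiindex :=
  [fsfun n in finsupp a => (a n - b n)%N | 0%N].

Definition meps (k : nat) : multiindex :=
  [fsfun n in [fset k]%fset => 1%N | 0%N].

Definition mle (a b : multiindex) : Prop := forall n, (a n <= b n)%N.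

Lemma maddE (a b : multiindex) (n : nat) : madd a b n = (a n + b n)%N.
Proof.
rewrite fsfunE in_fsetU; case: ifPn => //.
by rewrite negb_or => /andP[/fsfun_dflt-> /fsfun_dflt->].
Qed.

Lemma msubE (a b : multiindex) (n : nat) : msub a b n = (a n - b n)%N.
Proof. by rewrite fsfunE; case: ifPn => // /fsfun_dflt->. Qed.

Lemma mepsE (k n : nat) : meps k n = (n == k).
Proof. by rewrite fsfunE in_fset1; case: ifP. Qed.

(** Finiteness of the index sets of the sums in [skorokhod] and [wick] below;
    on an infinite support [\sum_(i \in A)] would be 0 by convention. *)
Lemma finite_madd_meps (c : multiindex) :
  finite_set [set q : multiindex * nat | madd q.1 (meps q.2) = c].
Proof.
pose g k := (msub c (meps k), k).
apply: (sub_finite_set (B := g @` [set` finsupp c])); last first.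
  exact/finite_image/finite_fset.
move=> [a k] /= e; exists k.
  by rewrite /= mem_finsupp -e maddE mepsE eqxx addn1.
by congr pair; apply/fsfunP => n; rewrite msubE -e maddE addnK.
Qed.

Lemma finite_mle (a : multiindex) : finite_set [set b | mle b a].
Proof.
pose m := (\sum_(n <- finsupp a) a n)%N.
pose g (h : {ffun finsupp a -> 'I_m.+1}) : multiindex :=
  [fsfun n : finsupp a => (h n : nat) | 0%N].
apply: (sub_finite_set (B := g @` [set: {ffun finsupp a -> 'I_m.+1}])).
  move=> b /= ba; exists [ffun n => inord (b (val n))] => //.
  apply/fsfunP => n; rewrite fsfun_ffun; case: insubP => [i ia <-|na] /=.
    rewrite ffunE inordK// ltnS (leq_trans (ba _))//.
    by rewrite /m (big_rem _ (fsvalP i)) leq_addr.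
  by apply/esym/eqP; have := ba n; rewrite [a n]fsfun_dflt // leqn0.
exact/finite_image/finite_finset.
Qed.

(** (2N)^(c a) *)
Definition mweight (R : realType) (c : R) (a : multiindex) : R :=
  \prod_(n <- finsupp a) ((2 * n.+1)%:R `^ (c * (a n)%:R)).

Section Spaces.
Context {R : realType} {X : completeNormedModType R}.

(** A formal series sum_a u_a H_a is its coefficient family [u]; a formal
    series sum_a sum_k f_(a,k) (x) xi_(k+1) (x) H_a is its coefficient
    family [f]. *)
Definition expansion := multiindex -> X.
Definition expansion2 := multiindex -> nat -> X.

(** X (x) (S)_{-1} *)
Definition XS : set expansion :=
  [set u | exists2 p : R, 0 <= p &
    (\esum_(a in [set: multiindex])
       (`|u a| ^+ 2 * mweight (- p) a)%:E < +oo)%E].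

(** X (x) S'(R) (x) (S)_{-1} *)
Definition XSS : set expansion2 :=
  [set f | exists l p : R, [/\ 0 <= l, 0 <= p &
    (\esum_(a in [set: multiindex]) \esum_(k in [set: nat])
       (`|f a k| ^+ 2 * (2 * k.+1)%:R `^ (- l) * mweight (- p) a)%:E
       < +oo)%E]].

(** Collecting coefficients in sum_a sum_k f_(a,k) H_(a+e_k): the coefficient
    of H_c is a sum over the finitely many (a, k) with a + e_k = c. *)
Definition skorokhod (f : expansion2) : expansion := fun c =>
  \sum_(q \in [set q : multiindex * nat | madd q.1 (meps q.2) = c]) f q.1 q.2.

(** Operators are total functions on coefficient families, constrained only
    on the space they act on.  Components are arbitrary maps X -> X: neither
    linearity nor continuity is assumed. *)
Definition coordinatewise (O : expansion -> expansion)
    (o : multiindex -> X -> X) : Prop :=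
  set_fun XS XS O /\ forall u, XS u -> O u = fun a => o a (u a).

Definition simple_coordinatewise (O : expansion -> expansion) : Prop :=
  exists o : X -> X, coordinatewise O (fun=> o).

Definition wick (B : multiindex -> X -> X) (u : expansion) : expansion :=
  fun a => \sum_(b \in [set b | mle b a]) B b (u (msub a b)).

(** sum_k v_k (x) xi_(k+1), whose coefficient at xi_(k+1) (x) H_a is the
    coefficient of v_k at H_a. *)
Definition xi_series (v : nat -> expansion) : expansion2 := fun a k => v k a.

(** M : X (x) (S)_{-1} -> X (x) S'(R) (x) (S)_{-1} with
    M u = sum_k M_k u (x) xi_(k+1), every M_k simple coordinatewise. *)
Definition simple_xi_form (M : expansion -> expansion2) : Prop :=
  set_fun XS XSS M /\
  exists Mk : nat -> expansion -> expansion,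
    (forall k, simple_coordinatewise (Mk k)) /\
    forall u, XS u -> M u = xi_series (fun k => Mk k u).

(** [B_a = 0] unless [a] is a unit multi-index *)
Definition unit_supported (B : multiindex -> X -> X) : Prop :=
  forall a, (forall k, a <> meps k) -> B a = fun=> 0.

End Spaces.

Arguments expansion {R} X.
Arguments expansion2 {R} X.

(* Main.v *)
(* Both spaces are spaces of coefficient families of polynomial growth in
   W(a) = (2N)^a, because sum_a W(a)^(-2) is finite: u is in X (x) (S)_{-1} iff
   |u_a| <= C W(a)^n, and f is in X (x) S'(R) (x) (S)_{-1} iff
   |f_(a,k)| <= C W(a + e_k)^n, for some C and n.  If B is supported on unit
   multi-indices, then B <> u is the Skorokhod integral of
   f_(a,k) = B_(e_k)(u_a), so the two descriptions are matched by
   B_(e_k) = o_k, with o_k the component of M_k.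

   From M to B, the coefficient of delta(f) at H_c has at most |supp c| <= W(c)
   summands f_(a,k) with a + e_k = c.  From B to M, the summands
   B_(e_k)(u_a) must be bounded individually although cancellation is possible
   in B <> u, and the maps B_(e_k) are arbitrary.  Apply B <> to the family v
   with v_(2a) = u_a that vanishes elsewhere: at 2a + e_k, by parity,
   (B <> v) - (B <> 0) reduces to B_(e_k)(u_a) - B_(e_k)(0), and B_(e_k)(0) is
   a coefficient of the image of 0 under the coordinatewise operator. *)
Require Import Defs.
From HB Require Import structures.
From mathcomp Require Import all_boot all_order all_algebra finmap.
From mathcomp Require Import all_classical all_reals all_analysis.
From mathcomp Require Import ring lra zify.

Set Implicit Arguments.
Unset Strict Implicit.
Unset Printing Implicit Defensive.

Import Order.TTheory GRing.Theory Num.Theory.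
Import numFieldNormedType.Exports.

Local Open Scope classical_set_scope.
Local Open Scope ring_scope.

(** * Sums of non-negative families and their finite partial sums *)

Lemma esum_bounded (R : realType) (T : choiceType) (f : T -> R) (C : R) :
  (forall s : seq T, uniq s -> \sum_(x <- s) f x <= C) ->
  (\esum_(x in [set: T]) (f x)%:E < +oo)%E.
Proof.
move=> fC; apply: (@le_lt_trans _ _ C%:E); last exact: ltry.
apply: ge_ereal_sup => _ [A [finA _] <-].
by rewrite fsbig_finite// sumEFin lee_fin fC// fset_uniq.
Qed.

Lemma esum_term_bounded (R : realType) (T : choiceType) (f : T -> R) :
  (forall x, 0 <= f x) -> (\esum_(x in [set: T]) (f x)%:E < +oo)%E ->
  exists2 C : R, 0 <= C & forall x, f x <= C.
Proof.
move=> f0 foo; have e0 : (0 <= \esum_(x in [set: T]) (f x)%:E)%E.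
  by apply: esum_ge0 => x _; rewrite lee_fin.
exists (fine (\esum_(x in [set: T]) (f x)%:E)); first exact: fine_ge0.
move=> x; rewrite -lee_fin fineK ?ge0_fin_numE//.
apply: esum_ge; exists [set x]; first by split.
by rewrite fsbig_set1.
Qed.

(** * The weights (2N)^a and their summability *)

Section Weights.
Context {R : realType}.
Implicit Types a b c : multiindex.

(** This is (2N)^a with natural exponents, so that ring laws apply; [mweightE] recovers the real
    exponents. *)
Definition mpow a : R := \prod_(n <- finsupp a) (2 * n.+1)%:R ^+ a n.

Lemma mpow_incl a (A : {fset nat}) : (finsupp a `<=` A)%fset ->
  mpow a = \prod_(n <- A) (2 * n.+1)%:R ^+ a n.
Proof. by move=> aA; apply: big_fset_incl => // n _ /fsfun_dflt->. Qed.

Lemma mweightE (r : R) a : mweight r a = mpow a `^ r.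
Proof.
rewrite /mweight /mpow; elim: (enum_fset _) => [|n s IHs].
  by rewrite !big_nil powR1.
rewrite !big_cons IHs powRM ?exprn_ge0 ?prodr_ge0//.
by congr (_ * _); rewrite mulrC powRrM powR_mulrn.
Qed.

Lemma mpow_ge1 a : 1 <= mpow a.
Proof.
rewrite /mpow; elim/big_ind: _ => // [x y|n _]; first exact: mulr_ege1.
by rewrite exprn_ege1// ler1n.
Qed.

Lemma mpow_gt0 a : 0 < mpow a.
Proof. exact: lt_le_trans (mpow_ge1 a). Qed.

Lemma mpow_ge0 a : 0 <= mpow a.
Proof. exact: ltW (mpow_gt0 a). Qed.

Lemma mpowD a b : mpow (madd a b) = mpow a * mpow b.
Proof.
pose A := (finsupp a `|` finsupp b)%fset.
have abA : (finsupp (madd a b) `<=` A)%fset.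
  apply/fsubsetP => n; rewrite inE !mem_finsupp maddE addn_eq0 negb_and.
  by case/orP => ->; rewrite ?orbT.
rewrite (mpow_incl abA) (mpow_incl (fsubsetUl _ _ : finsupp a `<=` A)%fset).
rewrite (mpow_incl (fsubsetUr _ _ : finsupp b `<=` A)%fset) -big_split.
by apply: eq_bigr => n _; rewrite /= maddE exprD.
Qed.

Lemma mpow_eps k : mpow (meps k) = (2 * k.+1)%:R.
Proof.
have kA : (finsupp (meps k) `<=` [fset k])%fset.
  by apply/fsubsetP => n; rewrite mem_finsupp inE mepsE; case: (n == k).
by rewrite (mpow_incl kA) big_seq_fset1 mepsE eqxx expr1.
Qed.

(** Each place of the support contributes a factor at least 2, and m < 2^m. This pays for the number
    of summands in a Skorokhod coefficient. *)
Lemma size_finsupp_mpow c : (size (finsupp c))%:R <= mpow c.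
Proof.
rewrite (@le_trans _ _ (2 ^+ size (finsupp c)))//.
  by rewrite -natrX ler_nat ltnW// ltn_expl.
have -> : 2 ^+ size (finsupp c) = \prod_(n <- finsupp c) 2 :> R.
  by rewrite big_const_seq count_predT iter_mulr_1.
rewrite /mpow big_seq [leRHS]big_seq.
apply: ler_prod => n; rewrite mem_finsupp -lt0n => n0.
rewrite ler0n/= (@le_trans _ _ (2 * n.+1)%:R) ?ler_nat ?leq_pmulr//.
by rewrite ler_eXnr// ler1n.
Qed.

Lemma mpow_ord a N : (forall n, n \in finsupp a -> (n < N)%N) ->
  mpow a = \prod_(i < N) (2 * i.+1)%:R ^+ a i.
Proof.
move=> aN; rewrite -(big_mkord xpredT (fun i => (2 * i.+1)%:R ^+ a i)).
rewrite (bigID (mem (finsupp a)))/= [X in _ * X]big1 ?mulr1; last first.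
  by move=> i /fsfun_dflt->.
rewrite -big_filter; apply: perm_big; apply: uniq_perm => //.
  by rewrite filter_uniq// iota_uniq.
move=> n; rewrite mem_filter mem_index_iota /=.
by case: (boolP (n \in finsupp a)) => //= /aN ->.
Qed.

(* The infinite product is the Wallis product [pi / 2]. *)
Lemma prod_geom_le (N : nat) :
  \prod_(i < N) (1 - ((2 * i.+1)%:R ^- 2))^-1 <= 2 - N.+1%:R^-1 :> R.
Proof.
elim: N => [|N IHN]; first by rewrite big_ord0; lra.
rewrite big_ord_recr/=.
have m1 : 1 <= N.+1%:R :> R by rewrite ler1n.
rewrite natrM -[N.+2]addn1 [(N.+1 + 1)%:R]natrD; move: m1 IHN.
move: (N.+1%:R) => m m1 IHN.
have d0 : 0 < 1 - (2 * m) ^- 2.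
  by rewrite subr_gt0 invf_lt1; nra.
apply: (@le_trans _ _ ((2 - m^-1) * (1 - (2 * m) ^- 2)^-1)).
  by rewrite ler_wpM2r// invr_ge0 ltW.
(* The deficit [m^-1] in the bound makes the induction close: 2 - 1/m = (2m - 1)/m cancels a factor
   of (2m)^2 - 1, and what remains is 4m(m + 1) <= (2m + 1)^2. *)
have -> : (2 - m^-1) * (1 - (2 * m) ^- 2)^-1 = 4 * m / (2 * m + 1).
  by field; rewrite ?lt0r_neq0//; nra.
have -> : 2 - (m + 1)^-1 = (2 * m + 1) / (m + 1).
  by field; rewrite ?lt0r_neq0//; nra.
rewrite ler_pdivrMr ?ltr_pwDr// ?mulr_ge0//; last lra.
rewrite mulrAC ler_pdivlMr; nra.
Qed.

(* Zhang's inequality: [\sum_a (2N)^(-2a)] is finite, being the product over n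
   of the geometric series of ratio [(2n)^-2]. *)
Lemma sum_mpowN2_le (s : seq multiindex) : uniq s ->
  \sum_(a <- s) mpow a ^- 2 <= 2.
Proof.
move=> us.
(* [N] bounds the places and [K] the entries occurring in [s], so [s] embeds into the box of
   functions ['I_N -> 'I_K.+1], over which the sum factors into truncated geometric series. *)
pose N := (\max_(a <- s) \max_(n <- finsupp a) n.+1)%N.
pose K := (\max_(a <- s) \max_(n <- finsupp a) a n)%N.
have sN a n : a \in s -> n \in finsupp a -> (n < N)%N.
  move=> sa an; apply: leq_trans (leq_bigmax_seq _ sa isT).
  exact: (leq_bigmax_seq (F := fun n => n.+1)).
have sK a n : a \in s -> (a n <= K)%N.
  move=> sa; case: (boolP (n \in finsupp a)) => [an|/fsfun_dflt->//].
  apply: leq_trans (leq_bigmax_seq _ sa isT).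
  exact: (leq_bigmax_seq (F := a)).
pose h a : {ffun 'I_N -> 'I_K.+1} := [ffun i : 'I_N => inord (a i)].
have hE a i : a \in s -> h a i = a i :> nat.
  by move=> sa; rewrite ffunE inordK// ltnS sK.
have uhs : uniq (map h s).
  rewrite map_inj_in_uniq// => a b sa sb hab; apply/fsfunP => n.
  have [nN|Nn] := ltnP n N.
    by rewrite -(hE a (Ordinal nN))// hab hE.
  rewrite !fsfun_dflt//; apply/negP => /sN; [move/(_ sb)|move/(_ sa)];
    by rewrite ltnNge Nn.
pose r (i : nat) : R := (2 * i.+1)%:R ^- 2.
have -> : \sum_(a <- s) mpow a ^- 2 =
    \sum_(f <- map h s) \prod_(i < N) r i ^+ f i.
  rewrite big_map; apply: eq_big_seq => a sa.
  rewrite (@mpow_ord a N); last by move=> n; exact: sN.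
  rewrite -prodrXl -prodfV; apply: eq_bigr => i _.
  by rewrite hE// /r exprVn -!exprM [(a i * 2)%N]mulnC.
rewrite (big_uniq _ uhs).
have r0 i : 0 <= r i by rewrite invr_ge0 exprn_ge0.
apply: (@le_trans _ _ (\sum_(f : {ffun 'I_N -> 'I_K.+1})
    \prod_(i < N) r i ^+ f i)).
  rewrite [leRHS](bigID (mem (map h s)))/= lerDl sumr_ge0// => f _.
  by rewrite prodr_ge0// => i _; rewrite exprn_ge0.
rewrite -(bigA_distr_bigA (fun (i : 'I_N) (j : 'I_K.+1) => r i ^+ j)).
apply: (@le_trans _ _ (\prod_(i < N) (1 - r i)^-1)); last first.
  by apply: le_trans (prod_geom_le N) _; rewrite lerBlDr lerDl invr_ge0.
apply: ler_prod => i _; rewrite sumr_ge0/=; last first.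
  by move=> j _; rewrite exprn_ge0.
have r1 : r i < 1.
  by rewrite invf_lt1 ?exprn_gt0 ?ltr0n// exprn_egt1// ltr1n; lia.
rewrite -[leRHS]mul1r ler_pdivlMr ?subr_gt0// mulrC.
by rewrite -opprB mulNr -subrX1 opprB lerBlDr lerDl exprn_ge0.
Qed.

End Weights.

(** * Reindexing of finite sums and unit multi-indices *)

Lemma fsbig_map (V : nmodType) (I T : choiceType) (A : set T) (s : seq I)
    (g : I -> T) (F : T -> V) :
  uniq s -> injective g -> (forall i, i \in s -> A (g i)) ->
  (forall x, A x -> ~ (exists2 i, i \in s & x = g i) -> F x = 0) ->
  \sum_(x \in A) F x = \sum_(i <- s) F (g i).
Proof.
move=> us ginj sA F0; rewrite (fsbigE (map g s)) ?map_inj_uniq//.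
- rewrite big_map big_seq_cond [RHS]big_seq; apply: eq_bigl => i.
  by case: (boolP (i \in s)) => //= /sA; exact: mem_set.
- by move=> _ /mapP[i si ->]; exact: sA.
- by move=> x Ax /mapP xs; exact: F0.
Qed.

Lemma meps_inj : injective meps.
Proof.
move=> j k /(congr1 (fun a : multiindex => a j)).
by rewrite !mepsE eqxx; case: eqP.
Qed.

Lemma msubK_eps (c : multiindex) k : k \in finsupp c ->
  madd (msub c (meps k)) (meps k) = c.
Proof.
rewrite mem_finsupp -lt0n => ck; apply/fsfunP => n.
rewrite maddE msubE mepsE subnK//.
by case: (eqVneq n k) => [->|_].
Qed.

Lemma maddK (a b : multiindex) : msub (madd a b) b = a.
Proof. by apply/fsfunP => n; rewrite msubE maddE addnK. Qed.

Lemma finsupp_madd_meps (a : multiindex) k : k \in finsupp (madd a (meps k)).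
Proof. by rewrite mem_finsupp maddE mepsE eqxx addn1. Qed.

(** The only odd entry of 2a + e_k is the one at k, so parity recovers k and then a. *)
Lemma madd_dbl_meps_inj :
  injective (fun q : multiindex * nat => madd (madd q.1 q.1) (meps q.2)).
Proof.
have par (a : multiindex) k n : odd (madd (madd a a) (meps k) n) = (n == k).
  by rewrite !maddE mepsE addnn oddD odd_double oddb.
move=> [a j] [b k] /= e.
have jk : j = k by apply/eqP; rewrite -(par b) -e par.
congr pair => //; apply/fsfunP => n.
have := congr1 (fun c : multiindex => c n) e.
by rewrite !maddE jk !addnn => /addIn/double_inj.
Qed.

(** * Both spaces as polynomial growth conditions *)

Section TemperedGrowth.
Context {R : realType} {X : completeNormedModType R}.

(** With y = w^n >= 1, one has x^2 <= C y <= ((1 + C) y)^2; the constant 1 + C replaces a square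
    root of C. *)
Lemma le_expr_of_weighted (x w p C : R) (n : nat) : 0 <= x -> 1 <= w ->
  0 <= C -> p <= n%:R -> x ^+ 2 * w `^ (- p) <= C -> x <= (1 + C) * w ^+ n.
Proof.
move=> x0 w1 C0 pn; have w0 : 0 < w := lt_le_trans ltr01 w1.
have w0' := ltW w0.
rewrite powRN ler_pdivrMr ?powR_gt0// => xC.
have wn1 : 1 <= w ^+ n by rewrite exprn_ege1.
have : x ^+ 2 <= C * w ^+ n.
  by apply: le_trans xC _; rewrite ler_wpM2l// -powR_mulrn// ler_powR.
move: wn1; move: (w ^+ n) => y y1 xy.
have y0 : 0 <= y := le_trans ler01 y1.
have C1 : 0 <= 1 + C by rewrite addr_ge0.
rewrite -(@ler_pXn2r _ 2) ?nnegrE ?mulr_ge0//.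
have : 0 <= (1 + C) * ((1 + C) * y) * (y - 1).
  by rewrite !mulr_ge0// subr_ge0.
have : 0 <= C * C * y by rewrite !mulr_ge0.
have : 0 <= C * y by rewrite !mulr_ge0.
nra.
Qed.

(** Of the exponent 2(n + m), the part 2n absorbs the growth of x and 2m is left as decay: m = 1
    suffices for sums over a, m = 2 for sums over pairs (a, k). *)
Lemma weighted_le_expr (x w C : R) (n m : nat) : 0 <= x -> 1 <= w ->
  x <= C * w ^+ n ->
  x ^+ 2 * w `^ (- (2 * (n + m))%:R) <= C ^+ 2 * w ^- (2 * m).
Proof.
move=> x0 w1 xC; have w0 : 0 < w := lt_le_trans ltr01 w1.
have w0' := ltW w0.
rewrite powRN powR_mulrn// ler_pdivrMr ?exprn_gt0//.
rewrite mulnDr exprD [w ^+ _ * _]mulrC -mulrA mulKf; last first.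
  by rewrite gt_eqF// exprn_gt0.
rewrite mulnC exprM -exprMn ler_pXn2r// nnegrE//.
exact: le_trans xC.
Qed.

Lemma XSP (u : expansion X) :
  XS u <-> exists C n, forall a, `|u a| <= C * mpow a ^+ n.
Proof.
split=> [[p p0 uoo]|[C [n uC]]].
  have [a|C C0 uC] := esum_term_bounded _ uoo.
    by rewrite mulr_ge0 ?exprn_ge0 ?mweightE ?powR_ge0.
  exists (1 + C), (Num.truncn p).+1 => a.
  apply: (@le_expr_of_weighted _ _ p) => //; first exact: mpow_ge1.
    by rewrite ltW// truncnS_gt.
  by rewrite -mweightE.
exists (2 * (n + 1))%:R => //; apply: (@esum_bounded _ _ _ (C ^+ 2 * 2)).
move=> s us; apply: (@le_trans _ _ (C ^+ 2 * \sum_(a <- s) mpow a ^- 2)).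
  rewrite mulr_sumr; apply: ler_sum => a _.
  by rewrite mweightE (@weighted_le_expr _ _ C n 1)// mpow_ge1.
by rewrite ler_wpM2l ?sqr_ge0// sum_mpowN2_le.
Qed.

Lemma XSSP (f : expansion2 X) : XSS f <->
  exists C n, forall a k, `|f a k| <= C * mpow (madd a (meps k)) ^+ n.
Proof.
pose g l p a k : R :=
  `|f a k| ^+ 2 * (2 * k.+1)%:R `^ (- l) * mweight (- p) a.
have pairs l p : (\esum_(a in [set: multiindex]) \esum_(k in [set: nat])
    (g l p a k)%:E = \esum_(q in [set: multiindex * nat]) (g l p q.1 q.2)%:E)%E.
  rewrite esum_esum; last first.
    by move=> a k _ _; rewrite lee_fin !mulr_ge0 ?mweightE ?powR_ge0.
  by congr esum; apply/seteqP; split.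
split=> [[l [p [l0 p0]]]|[C [n fC]]].
  rewrite pairs => foo; have [q|C C0 fC] := esum_term_bounded _ foo.
    by rewrite /g !mulr_ge0 ?mweightE ?powR_ge0.
  (* The weight of a + e_k carries a single exponent for both factors, so [l] and [p] are both
     raised to their maximum. *)
  exists (1 + C), (Num.truncn (Num.max l p)).+1 => a k.
  apply: (@le_expr_of_weighted _ _ (Num.max l p)) => //; first exact: mpow_ge1.
    by rewrite ltW// truncnS_gt.
  apply: le_trans (fC (a, k)); rewrite /g /= -mulrA ler_wpM2l ?sqr_ge0//.
  rewrite mpowD mpow_eps mulrC powRM ?mpow_ge0// mweightE.
  by rewrite ler_pM ?powR_ge0// ler_powR ?mpow_ge1 ?ler1n// lerN2 le_max
    lexx ?orbT.
pose N : R := (2 * (n + 2))%:R.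
exists N, N; split; rewrite ?ler0n// pairs.
apply: (@esum_bounded _ _ _ (C ^+ 2 * 2)) => s us.
(* The map to a + e_k is not injective on pairs, but 2a + e_k is, and its weight is at most the
   square of that of a + e_k. The double sum is thus dominated by a sum over distinct
   multi-indices. *)
pose h (q : multiindex * nat) := madd (madd q.1 q.1) (meps q.2).
apply: (@le_trans _ _ (C ^+ 2 * \sum_(q <- s) mpow (h q) ^- 2)).
  rewrite mulr_sumr; apply: ler_sum => -[a k] _.
  rewrite /g /= -mulrA mweightE -powRM// ?mpow_ge0//.
  rewrite [_ * mpow a]mulrC -mpow_eps -mpowD.
  have /le_trans := weighted_le_expr 2 (normr_ge0 _) (mpow_ge1 _) (fC a k).
  apply.
    rewrite ler_wpM2l ?sqr_ge0// lef_pV2 ?posrE ?exprn_gt0 ?mpow_gt0//.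
  rewrite exprM ler_pXn2r ?nnegrE ?exprn_ge0 ?mpow_ge0//.
  rewrite /h /= !mpowD expr2 mulrACA ler_wpM2l//.
    by rewrite mulr_ge0 ?mpow_ge0.
  by rewrite ler_peMr ?mpow_ge1 ?mpow_ge0.
rewrite ler_wpM2l ?sqr_ge0// -(big_map h xpredT (fun a => mpow a ^- 2)).
by rewrite sum_mpowN2_le// map_inj_uniq//; exact: madd_dbl_meps_inj.
Qed.

Lemma skorokhodE (f : expansion2 X) c :
  skorokhod f c = \sum_(k <- finsupp c) f (msub c (meps k)) k.
Proof.
rewrite /skorokhod (fsbig_map (g := fun k => (msub c (meps k), k))
  (s := finsupp c))//.
- by move=> j k [].
- by move=> k; exact: msubK_eps.
- move=> [a k] /= e []; exists k; rewrite -e ?maddK//.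
  exact: finsupp_madd_meps.
Qed.

Lemma wickE (B : multiindex -> X -> X) u c : unit_supported B ->
  wick B u c = \sum_(k <- finsupp c) B (meps k) (u (msub c (meps k))).
Proof.
move=> B0; rewrite /wick (fsbig_map (g := meps) (s := finsupp c))//.
- exact: meps_inj.
- move=> k ck n /=; rewrite -[in leqRHS](msubK_eps ck) maddE.
  exact: leq_addl.
- move=> a ac na; rewrite B0// => k ak; apply: na; exists k => //.
  by have := ac k; rewrite ak mepsE eqxx mem_finsupp lt0n.
Qed.

Lemma skorokhod_wick (B : multiindex -> X -> X) u : unit_supported B ->
  skorokhod (fun a k => B (meps k) (u a)) = wick B u.
Proof. by move=> B0; apply/funext => c; rewrite wickE// skorokhodE. Qed.

Lemma XS_skorokhod (f : expansion2 X) : XSS f -> XS (skorokhod f).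
Proof.
(* The extra power of the weight of [c] absorbs the number of summands. *)
move=> /XSSP[C [n fC]]; apply/XSP; exists C, n.+1 => c.
have w0 := mpow_gt0 (R := R) c.
have C0 : 0 <= C.
  have := le_trans (normr_ge0 _) (fC c 0%N).
  by rewrite pmulr_lge0// exprn_gt0// mpow_gt0.
rewrite skorokhodE; apply: le_trans (ler_norm_sum _ _ _) _.
apply: (@le_trans _ _ (\sum_(k <- finsupp c) C * mpow c ^+ n)).
  by rewrite big_seq [leRHS]big_seq; apply: ler_sum => k ck;
    rewrite -{2}(msubK_eps ck).
rewrite big_const_seq count_predT iter_addr_0 -[_ *+ _]mulr_natr exprSr mulrA.
by rewrite ler_wpM2l ?size_finsupp_mpow// mulr_ge0// exprn_ge0// ltW.
Qed.

End TemperedGrowth.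

(** * Isolating single components in the Wick action *)

Definition mhalf (a : multiindex) : multiindex :=
  [fsfun n in finsupp a => (a n)./2 | 0%N].

Lemma mhalfE (a : multiindex) n : mhalf a n = (a n)./2.
Proof. by rewrite fsfunE; case: ifPn => // /fsfun_dflt->. Qed.

Lemma mhalf_madd (a : multiindex) : mhalf (madd a a) = a.
Proof. by apply/fsfunP => n; rewrite mhalfE maddE addnn doubleK. Qed.

Section UnitSupported.
Context {R : realType} {X : completeNormedModType R}.
Implicit Types B : multiindex -> X -> X.

Lemma unit_supported_extension (o : nat -> X -> X) :
  exists2 B, unit_supported B & forall k, B (meps k) = o k.
Proof.
exists (fun a => if pselect (exists k, a = meps k) is left h
    then o (sval (cid h)) else fun=> 0) => [a na|k].
  by case: pselect => // -[k ak]; case: (na k).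
case: pselect => [h|[]]; last by exists k.
by rewrite -(meps_inj (svalP (cid h))).
Qed.

Lemma XS0 : XS (fun=> 0 : X).
Proof. by apply/XSP; exists 0, 0%N => a; rewrite normr0 mul0r. Qed.

(** Needed for [B] to be the components of a coordinatewise operator. At a = e_k the hypothesis
    bounds by the weight of 2e_k, a square, whence the exponent 2n. *)
Lemma XS_diag B u : unit_supported B ->
  XSS (fun a k => B (meps k) (u a)) -> XS (fun a => B a (u a)).
Proof.
move=> B0 /XSSP[C [n fC]]; apply/XSP; exists `|C|, (2 * n)%N => a.
have w0 := mpow_ge0 (R := R) a.
have [[k ->]|na] := pselect (exists k, a = meps k).
  apply: le_trans (fC _ _) _; rewrite mpowD -expr2 -exprM.
  by rewrite ler_wpM2r ?ler_norm// exprn_ge0// mpow_ge0.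
rewrite B0 ?normr0 ?mulr_ge0 ?exprn_ge0// => k ak.
by apply: na; exists k.
Qed.

Lemma XS_slice (f : expansion2 X) k : XSS f -> XS (f ^~ k).
Proof.
move=> /XSSP[C [n fC]]; apply/XSP.
exists (C * mpow (meps k) ^+ n), n => a.
by apply: le_trans (fC a k) _; rewrite mpowD exprMn mulrCA mulrC.
Qed.

(** Since [mhalf] rounds odd entries down, the test singles out the doubles 2a; there the family
    takes the value u_a. *)
Definition dilate (u : expansion X) : expansion X := fun b =>
  if b == madd (mhalf b) (mhalf b) then u (mhalf b) else 0.

Lemma XS_dilate u : XS u -> XS (dilate u).
Proof.
move=> /XSP[C [n uC]]; apply/XSP; exists `|C|, n => b.
have w0 := mpow_ge0 (R := R) b.
rewrite /dilate; case: eqP => [bE|_].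
  apply: le_trans (uC _) _; rewrite [in leRHS]bE mpowD; move: (mhalf b) => a.
  have a0 := mpow_ge0 (R := R) a.
  apply: le_trans (ler_wpM2r (exprn_ge0 _ a0) (ler_norm C)) _.
  by rewrite ler_wpM2l// lerXn2r ?nnegrE ?mulr_ge0// ler_peMr ?mpow_ge1.
by rewrite normr0 mulr_ge0 ?exprn_ge0.
Qed.

(* Every place other than k has an even entry in [2a + e_k], so only the summand
   [e_k] of the Wick sum meets the support of [dilate u]; subtracting
   [wick B 0] removes the contributions [B (meps j) 0] of the other ones. *)
Lemma wick_dilate B u a k : unit_supported B ->
  let c := madd (madd a a) (meps k) in
  B (meps k) (u a) =
    wick B (dilate u) c - wick B (fun=> 0) c + B (meps k) 0.
Proof.
move=> B0 c; rewrite !wickE// -sumrB.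
rewrite (bigD1_seq k (finsupp_madd_meps _ k) (fset_uniq _))/=.
rewrite big_seq_cond big1 => [|j /andP[cj jk]].
  by rewrite addr0 maddK /dilate mhalf_madd eqxx subrK.
rewrite /dilate; case: eqP => [e|_]; last by rewrite subrr.
have := msubK_eps cj; rewrite e => /(@madd_dbl_meps_inj (_, _) (_, _))[_ jk'].
by rewrite jk' eqxx in jk.
Qed.

Lemma XSS_of_wick B : unit_supported B -> set_fun XS XS (wick B) ->
  XS (fun a => B a 0) ->
  set_fun XS XSS (fun u a k => B (meps k) (u a)).
Proof.
move=> B0 wB /XSP[C3 [n3 b3]] u Xu.
have /XSP[C1 [n1 b1]] := wB _ (XS_dilate Xu).
have /XSP[C2 [n2 b2]] := wB _ XS0.
(* The weights of 2a + e_k and of e_k are at most [w ^+ 2], whence the factor 2; the sum dominates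
   each of the three exponents. *)
pose n := (2 * (n1 + n2 + n3))%N.
apply/XSSP; exists (`|C1| + `|C2| + `|C3|), n => a k.
set w := mpow _.
have w1 : 1 <= w := mpow_ge1 _.
have raise x y C m : 0 <= y -> y <= w ^+ 2 -> (m <= n1 + n2 + n3)%N ->
    x <= C * y ^+ m -> x <= `|C| * w ^+ n.
  move=> y0 yw mn /le_trans; apply.
  apply: le_trans (ler_wpM2r (exprn_ge0 _ y0) (ler_norm C)) _.
  rewrite ler_wpM2l// /n exprM.
  apply: (@le_trans _ _ ((w ^+ 2) ^+ m)); last first.
    by rewrite ler_weXn2l// exprn_ege1.
  by rewrite lerXn2r ?nnegrE ?exprn_ge0 ?mpow_ge0.
pose c := madd (madd a a) (meps k).
have ? : mpow c <= w ^+ 2.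
  rewrite /c /w !mpowD expr2 mulrACA ler_wpM2l ?mulr_ge0 ?mpow_ge0//.
  by rewrite ler_peMr ?mpow_ge1 ?mpow_ge0.
have ? : mpow (meps k) <= w ^+ 2.
  apply: (@le_trans _ _ w); last by rewrite ler_eXnr.
  by rewrite /w mpowD ler_peMl ?mpow_ge1 ?mpow_ge0.
rewrite (wick_dilate u a k B0) -/c !mulrDl.
apply: le_trans (ler_normD _ _) _; apply: lerD; last first.
  apply: raise (b3 (meps k)) => //; first exact: mpow_ge0.
  exact: leq_addl.
apply: le_trans (ler_normB _ _) _; apply: lerD.
  by apply: raise (b1 c) => //; [exact: mpow_ge0|rewrite -addnA leq_addr].
apply: raise (b2 c) => //; first exact: mpow_ge0.
by rewrite addnAC leq_addl.
Qed.

End UnitSupported.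

Theorem proposition2p8 (R : realType) (X : completeNormedModType R) :
  (forall M : expansion X -> expansion2 X, simple_xi_form M ->
     exists (O : expansion X -> expansion X) (B : multiindex -> X -> X),
       [/\ coordinatewise O B, set_fun XS XS (wick B), unit_supported B &
           forall u, XS u -> skorokhod (M u) = wick B u]) /\
  (forall (O : expansion X -> expansion X) (B : multiindex -> X -> X),
     coordinatewise O B -> set_fun XS XS (wick B) -> unit_supported B ->
     exists M : expansion X -> expansion2 X,
       simple_xi_form M /\
       forall u, XS u -> skorokhod (M u) = wick B u).
Proof.
split=> [M [MXSS [Mk [/choice[g Mg] ME]]]|O B [OXS OE] wB B0].
  have [B B0 Bg] := unit_supported_extension g.
  have MB u : XS u -> M u = fun a k => B (meps k) (u a).
    move=> Xu; rewrite ME//; apply/funext => a; apply/funext => k.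
    by rewrite /xi_series (Mg k).2// Bg.
  have BXSS u : XS u -> XSS (fun a k => B (meps k) (u a)).
    by move=> Xu; rewrite -MB//; exact: MXSS.
  (* The coordinatewise operator is the diagonal action of [B], distinct from its Wick action. *)
  exists (fun u a => B a (u a)), B; split=> //.
  - by split=> // u /BXSS; exact: XS_diag.
  - by move=> u Xu; rewrite -skorokhod_wick//; exact/XS_skorokhod/BXSS.
  - by move=> u Xu; rewrite MB// skorokhod_wick.
exists (fun u a k => B (meps k) (u a)); split; last first.
  by move=> u _; exact: skorokhod_wick.
have BXSS : set_fun XS XSS (fun u a k => B (meps k) (u a)).
  by apply: XSS_of_wick => //; rewrite -(OE _ XS0); exact/OXS/XS0.
split=> //; exists (fun k u a => B (meps k) (u a)); split=> // k.
by exists (B (meps k)); split=> // u /BXSS; exact: XS_slice.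
Qed.
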